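(* Let $\mathbf p=(p_n)\subset[1,\infty)$ be a sequence. The modular topology $\tau_{\rho_{\mathbf p}}$ on the variable exponent space $\ell^{(p_n)}$ is Hausdorff, even when the sequence $(p_n)$ is unbounded.
   Context: For $\mathbf p=(p_n)\subset[1,\infty)$ and a real sequence $(a_j)$, $\rho_{\mathbf p}((a_j))=\sum_{j=1}^\infty|a_j|^{p_j}\in[0,\infty]$, and $\ell^{(p_n)}=\{(a_j)\in\mathbb{R}^{\mathbb N}:\rho_{\mathbf p}(\lambda(a_j))<\infty\text{ for some }\lambda>0\}$. For $x\in\ell^{(p_n)}$ and $\varepsilon>0$, $B_{\rho_{\mathbf p},\varepsilon}(x)=\{y\in\ell^{(p_n)}:\rho_{\mathbf p}(y-x)<\varepsilon\}$. The modular topology $\tau_{\rho_{\mathbf p}}$: $A\subseteq\ell^{(p_n)}$ is open iff for every $x\in A$ there exists $\varepsilon>0$ with $B_{\rho_{\mathbf p},\varepsilon}(x)\subset A$. (The balls are not asserted to be open.) *)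

(* Defs.v *)
From HB Require Import structures.
From mathcomp Require Import all_boot all_order all_algebra.
From mathcomp Require Import all_classical all_reals all_analysis.
Set Implicit Arguments.
Unset Strict Implicit.
Unset Printing Implicit Defensive.
Import Order.TTheory GRing.Theory Num.Theory.
Import numFieldNormedType.Exports.
Local Open Scope classical_set_scope.
Local Open Scope ring_scope.

(* Sequences are indexed from 0 instead of 1. *)
Definition modular (R : realType) (p a : nat -> R) : \bar R :=
  (\sum_(0 <= j <oo) (`|a j| `^ p j)%:E)%E.

(* A record rather than [set_type], which already carries the topology induced
   by the product topology on R^nat. *)
Record varexp (R : realType) (p : nat -> R) := Varexp {
  varexp_seq :> nat -> R ;
  varexp_fin : exists2 lambda : R, 0 < lambda &
    (modular p (fun j => (lambda * varexp_seq j)%R) < +oo)%E }.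

HB.instance Definition _ (R : realType) (p : nat -> R) := gen_eqMixin (varexp p).
HB.instance Definition _ (R : realType) (p : nat -> R) :=
  gen_choiceMixin (varexp p).

Definition modular_ball (R : realType) (p : nat -> R) (x : varexp p) (eps : R) :
    set (varexp p) :=
  [set y | (modular p (fun j => (y j - x j)%R) < eps%:E)%E].

Definition modular_open (R : realType) (p : nat -> R) (A : set (varexp p)) :
    Prop :=
  forall x, A x -> exists2 eps : R, 0 < eps & modular_ball x eps `<=` A.

Lemma modular_openT (R : realType) (p : nat -> R) : @modular_open R p setT.
Proof. by move=> x _; exists 1. Qed.

Lemma modular_openI (R : realType) (p : nat -> R) :
  setI_closed (@modular_open R p).
Proof.
move=> A B oA oB x [/oA[e e0 eA] /oB[f f0 fB]].
exists (Num.min e f); first by rewrite lt_min e0.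
move=> y; rewrite /modular_ball /= => yx; split.
- by apply: eA; apply: lt_le_trans yx _; rewrite lee_fin ge_min lexx.
- by apply: fB; apply: lt_le_trans yx _; rewrite lee_fin ge_min lexx orbT.
Qed.

Lemma modular_open_bigU (R : realType) (p : nat -> R) (I : Type)
    (f : I -> set (varexp p)) :
  (forall i, modular_open (f i)) -> modular_open (\bigcup_i f i).
Proof.
move=> fo x [i _ /fo[e e0 ef]]; exists e => // y /ef fy.
by exists i.
Qed.

HB.instance Definition _ (R : realType) (p : nat -> R) :=
  isOpenTopological.Build (varexp p)
    (@modular_openT R p) (@modular_openI R p) (@modular_open_bigU R p).

Lemma open_varexpE (R : realType) (p : nat -> R) (A : set (varexp p)) :
  open A = modular_open A.
Proof. by []. Qed.

(* Main.v *)
Require Import Defs.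
From HB Require Import structures.
From mathcomp Require Import all_boot all_order all_algebra.
From mathcomp Require Import all_classical all_reals all_analysis.
Import Order.TTheory GRing.Theory Num.Theory.
Import numFieldNormedType.Exports.
Local Open Scope ring_scope.

(** Each coordinate evaluation is continuous for the modular topology, because
    [`|y j - x j| `^ p j] is one term of [modular p (y - x)] and is strictly
    increasing in [`|y j - x j|].  Coordinates separate points and the real
    line is Hausdorff, so distinct sequences are separated along one coordinate. *)

Lemma modular_ge_term (R : realType) (p a : nat -> R) (j : nat) :
  ((`|a j| `^ p j)%:E <= modular p a)%E.
Proof.
have t0 n : (0 <= (`|a n| `^ p n)%:E)%E by rewrite lee_fin powR_ge0.
apply: (@le_trans _ _ (\sum_(0 <= i < j.+1) (`|a i| `^ p i)%:E)%E).
  by rewrite big_nat_recr//= leeDr// sume_ge0.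
exact: nneseries_lim_ge.
Qed.

(** The field [varexp_fin] lives in [Prop], so proof irrelevance identifies its witnesses. *)
Lemma varexp_inj (R : realType) (p : nat -> R) : injective (@varexp_seq R p).
Proof.
by move=> [x hx] [y hy] /= xy; case: _ / xy in hy *; congr Varexp.
Qed.

Lemma coord_continuous (R : realType) (p : nat -> R) (j : nat) :
  0 < p j -> continuous (fun x : varexp p => x j : R).
Proof.
move=> pj0; apply/continuousP => A oA; rewrite open_varexpE => x Axj.
have [e /= e0 eA] := open_nbhs_nbhs (conj oA Axj).
(* If [e <= |y j - x j|], the [j]-th term alone would reach this radius. Only the single exponent
   [p j] enters, so no bound on [p] is required. *)
exists (e `^ p j); first exact: powR_gt0.
move=> y xy; apply: eA => /=; rewrite distrC ltNge; apply/negP => ley.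
have := le_lt_trans (modular_ge_term _ _ (fun i => y i - x i) j) xy.
by rewrite lte_fin ltNge ge0_ler_powR// ?nnegrE// ltW.
Qed.

Theorem theorem6p7 (R : realType) (p : nat -> R) (hp : forall n, 1 <= p n) :
  hausdorff_space (varexp p).
Proof.
move=> x y xy; apply/varexp_inj/funext => j.
have cj := coord_continuous _ p j (lt_le_trans ltr01 (hp j)).
(* [xy] says that neighbourhoods of [x] and [y] always meet; applied to preimages under the [j]-th
   coordinate, it makes those of [x j] and [y j] meet. *)
apply: Rhausdorff => A B /cj Ax /cj By.
by have [z [Az Bz]] := xy _ _ Ax By; exists (z j).
Qed.
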